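(* Let $G=(V,E)$ be a finite connected $d$-regular graph, let $\Sigma\subset V$ separate $V\setminus\Sigma$ into $V^+$ and $V^-$, with signed distance $\mathrm{dist}_\Sigma$. Let $\nu,\mu:\mathbb{Z}\to\mathbb{R}$ satisfy $|\Sigma|\mu(k)\le|\mathrm{dist}_\Sigma^{-1}(k)|\le|\Sigma|\nu(k)$ for all $k\in\mathbb{Z}$, let $T^+\in\mathbb{Z}_{>0}$ with $\mu(k)>0$ for $0\le k\le T^+$, and $T^-\in\mathbb{Z}_{<0}$ with $\mu(k)>0$ for $T^-\le k\le0$. Define the symmetric tridiagonal matrix $A^+$ indexed by $\{1,\dots,T^+\}$ by $A^+_{ii}=\frac{2\nu(i)+\nu(i-1)+\nu(i+1)}{\mu(i)}$ for $1\le i<T^+$, $A^+_{T^+T^+}=\frac{\nu(T^+)+\nu(T^+-1)}{\mu(T^+)}$, $A^+_{ij}=\frac{-\nu(i)-\nu(j)}{\sqrt{\mu(i)\mu(j)}}$ if $|i-j|=1$, and $A^+_{ij}=0$ otherwise; and $A^-$ indexed by $\{T^-,\dots,-1\}$ by $A^-_{ii}=\frac{2\nu(i)+\nu(i-1)+\nu(i+1)}{\mu(i)}$ for $T^-<i\le-1$, $A^-_{T^-T^-}=\frac{\nu(T^-)+\nu(T^-+1)}{\mu(T^-)}$, $A^-_{ij}=\frac{-\nu(i)-\nu(j)}{\sqrt{\mu(i)\mu(j)}}$ if $|i-j|=1$, and $A^-_{ij}=0$ otherwise. Let $\rho^+_k$ (resp. $\rho^-_l$) denote the $k$-th (resp.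 $l$-th) smallest eigenvalue of $A^+$ (resp. $A^-$), counted with multiplicity. Then for all $k,l\in\mathbb{N}$ with $1\le k,l\le T:=\min\{|T^-|,T^+\}$, $$\lambda_{k+l}(G)\le\tfrac12\max\{\rho^+_k,\rho^-_l\}.$$ In particular, $$\lambda_j(G)\le\tfrac12\min_{j=k+l}\ \min_{\substack{j\le t^++|t^-|\le 2T\\ t^+,-t^-\ge1}}\max\{\rho^+_k(t^+),\rho^-_l(|t^-|)\},$$ where $\rho^+_k(t^+)$ and $\rho^-_l(|t^-|)$ are the $k$-th and $l$-th eigenvalues of the matrices $A^+(t^+)$ and $A^-(t^-)$ obtained by replacing $T^+$ by $t^+$ and $T^-$ by $t^-$ in the definitions of $A^+$ and $A^-$, and the minimum ranges over $k,l\ge1$ with $k\le t^+$, $l\le|t^-|$.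
   Context: The (normalized) Laplacian of a $d$-regular graph is $\Delta f(x)=\frac1d\sum_{y\sim x}(f(x)-f(y))$, with eigenvalues counted with multiplicity $0=\lambda_1(G)\le\lambda_2(G)\le\cdots$. $\Sigma\subset V$ separates $V\setminus\Sigma$ into $V^+,V^-$ if $V\setminus\Sigma=V^+\sqcup V^-$ with no edges between $V^+$ and $V^-$. The signed distance $\mathrm{dist}_\Sigma$ has absolute value equal to the graph distance to $\Sigma$, positive on $V^+$, negative on $V^-$.
   Formalization: In the double minimum, t⁺ and t⁻ are restricted to levels with μ>0 on 0..t⁺ and on t⁻..0 (otherwise A^±(t^±) may be undefined, e.g. μ(t⁺)=0 with t⁺>T⁺); j ranges over 2≤j≤2T, and Σ is assumed nonempty. *)

(* Defs.v *)
From HB Require Import structures.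
From mathcomp Require Import all_boot all_order all_algebra.
From mathcomp Require Import reals.
From mathcomp Require Import polyrcf.

Set Implicit Arguments.
Unset Strict Implicit.
Unset Printing Implicit Defensive.

Import Order.TTheory GRing.Theory Num.Theory.
Local Open Scope ring_scope.

Section Graph.
Variables (V : finType) (e : rel V).

Definition simple_graph : Prop := symmetric e /\ irreflexive e.

Definition connected_graph : Prop := forall x y : V, connect e x y.

Definition regular_graph (d : nat) : Prop :=
  forall x : V, #|[set y | e x y]| = d.

(* The length of a shortest walk from x to y; the junk value #|V| is returned
   when there is none. *)
Definition gdist (x y : V) : nat :=
  find (fun n => [exists p : n.-tuple V, path e x p && (last x p == y)])
       (iota 0 #|V|).

(* Meaningful for nonempty S only: every distance in a connected graph is
   < #|V|. *)
Definition gdist_set (S : {set V}) (x : V) : nat :=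
  \big[minn/#|V|]_(y in S) gdist x y.

Definition separates (S Vp Vm : {set V}) : Prop :=
  [/\ ~: S = Vp :|: Vm, [disjoint Vp & Vm]
    & forall x y, x \in Vp -> y \in Vm -> ~~ e x y].

Definition signed_dist (S Vp : {set V}) (x : V) : int :=
  if x \in Vp then (gdist_set S x)%:Z else - (gdist_set S x)%:Z.

Definition laplacian (R : realType) (d : nat) (f : V -> R) (x : V) : R :=
  d%:R^-1 * \sum_(y | e x y) (f x - f y).

(* The matrix of the operator f |-> laplacian d f in the basis of indicator
   functions of the vertices. *)
Definition laplacian_mx (R : realType) (d : nat) : 'M[R]_#|V| :=
  \matrix_(i, j)
    laplacian d (fun y => (y == enum_val j)%:R) (enum_val i).

End Graph.

(* The real roots of the characteristic polynomial in increasing order (rootsR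
   is strictly sorted), each repeated according to its multiplicity. *)
Definition spectrum (R : realType) (n : nat) (A : 'M[R]_n) : seq R :=
  flatten [seq nseq (mup x (char_poly A)) x | x <- rootsR (char_poly A)].

(* k-th smallest eigenvalue, with k counted from 1. *)
Definition eig (R : realType) (n : nat) (A : 'M[R]_n) (k : nat) : R :=
  nth 0 (spectrum A) k.-1.

Definition lambda (R : realType) (V : finType) (e : rel V) (d k : nat) : R :=
  eig (laplacian_mx e R d) k.

Section Tridiagonal.
Variables (R : realType) (mu nu : int -> R).

Definition Aplus_entry (T i j : int) : R :=
  if i == j then
    if i == T then (nu T + nu (T - 1)) / mu T
    else (2 * nu i + nu (i - 1) + nu (i + 1)) / mu i
  else if (`|i - j| == 1)%N then (- nu i - nu j) / Num.sqrt (mu i * mu j)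
  else 0.

Definition Aminus_entry (T i j : int) : R :=
  if i == j then
    if i == T then (nu T + nu (T + 1)) / mu T
    else (2 * nu i + nu (i - 1) + nu (i + 1)) / mu i
  else if (`|i - j| == 1)%N then (- nu i - nu j) / Num.sqrt (mu i * mu j)
  else 0.

(* For T > 0: ordinal i stands for the index i + 1 of {1, ..., T}. *)
Definition Aplus (T : int) : 'M[R]_`|T|%N :=
  \matrix_(i, j) Aplus_entry T ((i : nat)%:Z + 1) ((j : nat)%:Z + 1).

(* For T < 0: ordinal i stands for the index T + i of {T, ..., -1}. *)
Definition Aminus (T : int) : 'M[R]_`|T|%N :=
  \matrix_(i, j) Aminus_entry T (T + (i : nat)%:Z) (T + (j : nat)%:Z).

Definition rho_plus (T : int) (k : nat) : R := eig (Aplus T) k.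
Definition rho_minus (T : int) (l : nat) : R := eig (Aminus T) l.

(* The conditions on a truncation level under which Aplus, resp. Aminus, is
   defined (no division by zero, no root of a negative number). *)
Definition admissible_plus (T : int) : Prop :=
  0 < T /\ forall k : int, 0 <= k <= T -> 0 < mu k.
Definition admissible_minus (T : int) : Prop :=
  T < 0 /\ forall k : int, T <= k <= 0 -> 0 < mu k.

(* The values over which the double minimum bounding the j-th Laplace
   eigenvalue is taken. *)
Definition max_rho_values (T j : nat) (r : R) : Prop :=
  exists (k l : nat) (tp tm : int),
    [/\ j = (k + l)%N,
        [/\ admissible_plus tp, admissible_minus tm
          & (j <= `|tp| + `|tm| <= 2 * T)%N],
        (1 <= k <= `|tp|)%N, (1 <= l <= `|tm|)%N
      & r = Num.max (rho_plus tp k) (rho_minus tm l)].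

End Tridiagonal.

Definition is_minimum (R : realType) (P : R -> Prop) (m : R) : Prop :=
  P m /\ forall r : R, P r -> m <= r.

(* Main.v *)
(** Min-max with radial test functions. Vectors [a] on [{1, ..., t+}] and [b] on
    [{t-, ..., -1}] give the function on the vertices that takes the value
    [a_i / sqrt (mu i)] (resp. [b_i / sqrt (mu i)]) at signed distance [i],
    vanishes on the separator and is constant beyond the truncation levels. Its
    squared norm is at least [|Sigma| (|a|^2 + |b|^2)]. The signed distance
    changes by at most 1 along an edge, and at most [d] times the mean of two
    consecutive level sizes edges join these levels, so that its Dirichlet
    energy is at most half of [|Sigma|] times the sum of the quadratic forms of
    [A+] at [a] and [A-] at [b]. Letting [a] and [b] range over the spans of the
    first [k] and [l] eigenvectors yields a [(k + l)]-dimensional test space for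
    the Laplacian. *)

Require Import Defs.
From mathcomp Require Import all_boot all_order all_algebra.
From mathcomp Require Import reals.
From mathcomp Require Import boolp perm spectral polyrcf complex.
From mathcomp Require Import zify ring lra.

Set Implicit Arguments.
Unset Strict Implicit.
Unset Printing Implicit Defensive.

Import Order.TTheory GRing.Theory Num.Theory.
Local Open Scope ring_scope.

Local Notation "M ^t*" := (map_mx Num.conj M^T).

(** * Quadratic forms and the spectral theorem for real symmetric matrices *)

Definition qform (R : realType) (n : nat) (A : 'M[R]_n) (u : 'rV[R]_n) : R :=
  (u *m A *m u^T) 0 0.

Definition sqnorm (R : realType) (n : nat) (u : 'rV[R]_n) : R :=
  (u *m u^T) 0 0.

Lemma sqnormE (R : realType) n (u : 'rV[R]_n) :
  sqnorm u = \sum_i u 0 i ^+ 2.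
Proof. by rewrite /sqnorm mxE; apply: eq_bigr => i _; rewrite mxE expr2. Qed.

Lemma sqnorm_ge0 (R : realType) n (u : 'rV[R]_n) : 0 <= sqnorm u.
Proof. by rewrite sqnormE sumr_ge0 // => i _; rewrite sqr_ge0. Qed.

Lemma sqnorm_gt0 (R : realType) n (u : 'rV[R]_n) : (0 < sqnorm u) = (u != 0).
Proof.
rewrite lt0r sqnorm_ge0 andbT; congr (~~ _); apply/eqP/eqP => [|->]; last first.
  by rewrite /sqnorm mul0mx mxE.
rewrite sqnormE => /psumr_eq0P H; apply/rowP => i; rewrite mxE.
by apply/eqP; rewrite -sqrf_eq0; apply/eqP/H => // j _; rewrite sqr_ge0.
Qed.

(** Over the complex numbers some eigenvalue [z] exists, with eigenvector [v]. As [A] is real and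
    symmetric, [v A v^*] equals both [z |v|^2] and its conjugate, so [z] is real, and a real root of
    the characteristic polynomial is an eigenvalue over the reals. *)
Lemma eigenvalue_symmetric_real (R : realType) n (A : 'M[R]_n.+1) :
  A^T = A -> exists a, eigenvalue A a.
Proof.
move=> symA; pose f := real_complex R.
have [z /eigenvalueP[v vA v_neq0]] := eigenvalue_closed (map_mx f A) (ltn0Sn n).
have fA_herm : (map_mx f A) ^t* = map_mx f A.
  apply/matrixP => i j; rewrite !mxE -[in RHS]symA mxE.
  by apply/CrealP; rewrite complex_real.
have v_norm : (v *m v ^t*) 0 0 != 0.
  apply: contraNneq v_neq0; rewrite mxE => /psumr_eq0P H.
  apply/eqP/rowP => i; rewrite mxE; apply/eqP; rewrite -normr_eq0 -sqrf_eq0.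
  rewrite normCK; apply/eqP.
  have := H _ i isT; rewrite !mxE; apply => j _.
  by rewrite !mxE -normCK exprn_ge0.
have zreal : z \is Num.real.
  apply/CrealP; apply: (mulIf v_norm).
  have E1 : v *m map_mx f A *m v ^t* = z *: (v *m v ^t*) by rewrite vA scalemxAl.
  have E2 : v *m map_mx f A *m v ^t* = z^* *: (v *m v ^t*).
    rewrite -{1}fA_herm -mulmxA -[_ *m v ^t*]map_mxM -trmx_mul vA.
    by rewrite linearZ /= map_mxZ scalemxAr.
  have := congr1 (fun M : 'M_1 => M 0 0) (etrans (esym E2) E1).
  by rewrite mxE [in RHS]mxE.
have zE : z = f (complex.Re z) by rewrite /f RRe_real.
exists (complex.Re z); rewrite eigenvalue_root_char -(fmorph_root f).
rewrite map_char_poly [X in root _ X](_ : _ = z); last exact: esym zE.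
by rewrite -eigenvalue_root_char; apply/eigenvalueP; exists v.
Qed.

(* The reflection exchanging [u] and [v]. *)
Lemma householder (R : realType) n (u v : 'rV[R]_n) :
  sqnorm u = 1 -> sqnorm v = 1 ->
  exists H : 'M[R]_n, [/\ H^T = H, H *m H = 1%:M & u *m H = v].
Proof.
move=> u1 v1; have [<-|neq_uv] := eqVneq u v.
  by exists 1%:M; rewrite trmx1 !mulmx1.
have [w wE] : exists w, w = u - v by exists (u - v).
pose s := sqnorm w; pose c := 2 / s.
have s_neq0 : s != 0 by rewrite gt_eqF // sqnorm_gt0 wE subr_eq0.
have ww : w *m w^T = s%:M by rewrite [LHS]mx11_scalar.
(* Since [u] and [v] have equal norms, [u] has inner product [s / 2] with [w], so reflecting [u]
   along [w] subtracts exactly [w]. *)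
have uw : u *m w^T = (s / 2)%:M.
  rewrite [LHS]mx11_scalar; congr (_%:M).
  have vuC : (v *m u^T) 0 0 = (u *m v^T) 0 0.
    by rewrite -[v *m _]trmxK trmx_mul trmxK mxE.
  have : s = 2 * (u *m w^T) 0 0.
    rewrite /s /sqnorm wE linearB /= mulmxBl !mulmxBr !mxE.
    move: u1 v1 vuC; rewrite /sqnorm !mxE => -> -> ->; ring.
  by move=> ->; field.
exists (1%:M - c *: (w^T *m w)); split.
- by rewrite linearB /= trmx1 linearZ /= trmx_mul trmxK.
- rewrite mulmxBl !mulmxBr !mul1mx mulmx1 -!scalemxAl -!scalemxAr.
  rewrite -mulmxA (mulmxA w) ww mul_scalar_mx -!scalemxAr !scalerA.
  rewrite -scalerBl -addrA -opprD -scalerDl [X in X *: _](_ : _ = 0).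
    by rewrite scale0r subr0.
  by rewrite /c; field.
- rewrite mulmxBr mulmx1 -scalemxAr mulmxA uw mul_scalar_mx scalerA.
  by rewrite (_ : c * _ = 1) ?scale1r ?wE ?subKr // /c; field.
Qed.

(** Induction on the size: conjugating by a reflection [H] that carries the first basis vector to a
    unit eigenvector splits off a block of size 1 and leaves a smaller symmetric block. *)
Lemma symmetric_diagonalization (R : realType) n (A : 'M[R]_n) :
  A^T = A ->
  exists (P : 'M[R]_n) (D : 'rV[R]_n),
    P *m P^T = 1%:M /\ A = P^T *m diag_mx D *m P.
Proof.
elim: n A => [|n IH] A symA.
  by exists 1%:M, 0; split; apply/matrixP => -[].
have [a /eigenvalueP[v0 v0A v0_neq0]] := eigenvalue_symmetric_real symA.
pose v := (Num.sqrt (sqnorm v0))^-1 *: v0.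
have s_gt0 : 0 < sqnorm v0 by rewrite sqnorm_gt0.
have v1 : sqnorm v = 1.
  rewrite /sqnorm linearZ /= -scalemxAl -scalemxAr scalerA [LHS]mxE.
  by rewrite -/(sqnorm v0) -expr2 exprVn sqr_sqrtr ?ltW // mulVf ?gt_eqF.
have vA : v *m A = a *: v by rewrite /v -scalemxAl v0A !scalerA mulrC.
have u1 : sqnorm (delta_mx 0 0 : 'rV[R]_n.+1) = 1.
  by rewrite /sqnorm trmx_delta mul_delta_mx mxE.
have [H [symH HH uH]] := householder u1 v1.
have [B BE] : exists B : 'M_(1 + n), B = H *m A *m H by exists (H *m A *m H).
have symB : B^T = B by rewrite BE !trmx_mul symH symA mulmxA.
(* The first basis vector is an eigenvector of [B], which clears the rest of the first row; symmetry
   then clears the first column. *)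
have row0B : row 0 B = a *: delta_mx 0 0.
  rewrite rowE BE !mulmxA uH vA -scalemxAl; congr (_ *: _).
  by rewrite -uH -mulmxA HH mulmx1.
have Bur : ursubmx B = 0.
  apply/rowP => j; have /rowP/(_ (rshift 1 j)) := row0B.
  by rewrite !mxE /= mulr0 => <-; congr (B _ _); apply: val_inj.
have Bdl : dlsubmx B = 0 by rewrite -[dlsubmx B]trmxK trmx_dlsub symB Bur trmx0.
have Bul : ulsubmx B = a%:M.
  apply/rowP => j; have /rowP/(_ (lshift n j)) := row0B.
  by rewrite !mxE !ord1 /= !mulr1 => <-; congr (B _ _); apply: val_inj.
have symA' : (drsubmx B)^T = drsubmx B by rewrite trmx_drsub symB.
have [P' [D' [P'P' EA']]] := IH _ symA'.
pose Q : 'M_(1 + n) := block_mx 1%:M 0 0 P'.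
have QQ : Q *m Q^T = 1%:M.
  rewrite /Q tr_block_mx mulmx_block.
  rewrite !(mulmx0, mul0mx, addr0, add0r, trmx0, trmx1, mul1mx, P'P').
  by rewrite -scalar_mx_block.
have EB : B = Q^T *m diag_mx (row_mx a%:M D') *m Q.
  rewrite -[B]submxK Bur Bdl Bul EA' /Q tr_block_mx diag_mx_row !mulmx_block.
  rewrite !(mulmx0, mul0mx, addr0, add0r, trmx0, trmx1, mul1mx, mulmx1).
  by congr block_mx; apply/rowP => i; rewrite !mxE !ord1.
exists (Q *m H), (row_mx a%:M D'); split.
- by rewrite trmx_mul symH mulmxA -(mulmxA Q) HH mulmx1.
- rewrite trmx_mul symH -2!mulmxA (mulmxA Q^T) (mulmxA _ Q) -EB BE.
  by rewrite -!mulmxA HH mulmx1 mulmxA HH mul1mx.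
Qed.

Lemma char_poly_orthogonal_conj (R : realType) n (P B : 'M[R]_n) :
  P *m P^T = 1%:M -> char_poly (P^T *m B *m P) = char_poly B.
Proof.
move=> PPt; have PtP := mulmx1C PPt; rewrite /char_poly.
have -> : char_poly_mx (P^T *m B *m P) =
    map_mx polyC P^T *m char_poly_mx B *m map_mx polyC P.
  rewrite /char_poly_mx mulmxBr mulmxBl !map_mxM; congr (_ - _).
  by rewrite mul_mx_scalar -scalemxAl -map_mxM PtP map_mx1 scalemx1.
rewrite !det_mulmx mulrAC -det_mulmx -map_mxM PtP map_mx1 det1.
by rewrite mul1r.
Qed.

Lemma mup_prod_XsubC (R : realType) (x : R) (s : seq R) :
  mup x (\prod_(a <- s) ('X - a%:P)) = count_mem x s.
Proof.
elim: s => [|a s IHs] /=.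
  by rewrite big_nil mupNroot // rootC oner_eq0.
rewrite big_cons mupM ?polyXsubC_eq0 //; last first.
  by rewrite monic_neq0 // monic_prod // => i _; rewrite monicXsubC.
by rewrite IHs -(expr1 ('X - a%:P)) mup_XsubCX; case: eqVneq.
Qed.

(** Each [x] occurs equally often on both sides, namely as often as its multiplicity as a root:
    [rootsR] lists every root once, so only one block of the flattened list contributes to the
    count. *)
Lemma spectrum_perm (R : realType) n (A : 'M[R]_n) (s : seq R) :
  char_poly A = \prod_(a <- s) ('X - a%:P) -> perm_eq (spectrum A) s.
Proof.
move=> pE; apply/allP => x _ /=; apply/eqP.
have p_neq0 : char_poly A != 0 by rewrite monic_neq0 // char_poly_monic.
rewrite -(mup_prod_XsubC x s) -pE count_flatten sumnE !big_map.
have uniqR : uniq (rootsR (char_poly A)).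
  exact: (sorted_uniq lt_trans ltxx (sorted_roots _ _ _)).
under eq_bigr do rewrite count_nseq /=.
have [xR|xNR] := boolP (x \in rootsR (char_poly A)).
  rewrite (big_rem x) //= eqxx mul1n big1_seq ?addn0 // => y /=.
  by rewrite mem_rem_uniq // inE => /andP[/negPf ->].
rewrite big1_seq => [|y /= yR]; last first.
  by case: eqVneq yR xNR => [->|//] ->.
rewrite mupNroot //; apply: contra xNR => xr.
by have := roots_on_rootsR p_neq0 x; rewrite in_itv /= xr => <-.
Qed.

Lemma sorted_spectrum (R : realType) n (A : 'M[R]_n) :
  sorted <=%R (spectrum A).
Proof.
have : sorted <%R (rootsR (char_poly A)) by exact: sorted_roots.
rewrite (sorted_pairwise le_trans) (sorted_pairwise lt_trans) /spectrum.
elim: (rootsR _) => //= a s IHs /andP[/allP lt_as /IHs lts].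
rewrite pairwise_cat lts andbT; apply/andP; split; last first.
  by elim: (mup _ _) => //= m ->; rewrite andbT; apply/allP => y /nseqP[->].
apply/allrelP => x y /nseqP[-> _] /flattenP[_ /mapP[z zs ->] /nseqP[-> _]].
exact/ltW/lt_as.
Qed.

(** The diagonal entries of any orthogonal diagonalization are a permutation of the spectrum;
    permuting the rows of [P] accordingly puts the eigenvalues in increasing order. *)
Lemma spectral_theorem (R : realType) n (A : 'M[R]_n) :
  A^T = A ->
  exists P : 'M[R]_n,
    [/\ P *m P^T = 1%:M, size (spectrum A) = n
      & A = P^T *m diag_mx (\row_i (spectrum A)`_i) *m P].
Proof.
move=> symA; have [P [D [PPt AE]]] := symmetric_diagonalization symA.
have permD : perm_eq (spectrum A) [tuple D 0 i | i < n].
  apply: spectrum_perm.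
  rewrite AE char_poly_orthogonal_conj // char_poly_trig ?diag_mx_is_trig //.
  by rewrite big_map big_enum; apply: eq_bigr => i _; rewrite !mxE eqxx.
have szA : size (spectrum A) = n by rewrite (perm_size permD) size_tuple.
have /tuple_permP[s sE] := permD.
exists (row_perm s P); split=> //.
  apply/matrixP => i j; have /matrixP/(_ (s i) (s j)) := PPt.
  rewrite !mxE (inj_eq perm_inj) => <-.
  by apply: eq_bigr => a _; rewrite !mxE.
rewrite {1}AE !mul_mx_diag; apply/matrixP => i j; rewrite !mxE.
rewrite (reindex_inj (@perm_inj _ s)); apply: eq_bigr => a _; rewrite !mxE.
rewrite sE (nth_map a) ?size_enum_ord // nth_ord_enum.
by rewrite tnth_mktuple.
Qed.

(** * Rayleigh quotients and test spaces *)

Lemma qform_diag (R : realType) n (A P : 'M[R]_n) (D v : 'rV[R]_n) :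
  A = P^T *m diag_mx D *m P ->
  qform A v = \sum_i D 0 i * (v *m P^T) 0 i ^+ 2.
Proof.
move=> ->; rewrite /qform.
have -> : v *m (P^T *m diag_mx D *m P) *m v^T =
    (v *m P^T) *m diag_mx D *m (v *m P^T)^T.
  by rewrite trmx_mul trmxK !mulmxA.
rewrite mul_mx_diag mxE; apply: eq_bigr => i _; rewrite !mxE; ring.
Qed.

Lemma sqnorm_orthogonal (R : realType) n (P : 'M[R]_n) (u : 'rV[R]_n) :
  P *m P^T = 1%:M -> sqnorm (u *m P) = sqnorm u.
Proof.
by move=> PPt; rewrite /sqnorm trmx_mul mulmxA -(mulmxA u) PPt mulmx1.
Qed.

Lemma nth_spectrum_le (R : realType) n (A : 'M[R]_n) i j :
  (i <= j < size (spectrum A))%N -> (spectrum A)`_i <= (spectrum A)`_j.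
Proof.
move=> /andP[ij js].
apply: (sorted_leq_nth le_trans lexx _ (sorted_spectrum A)) => //.
by rewrite inE (leq_ltn_trans ij).
Qed.

(** By a dimension count, the test space contains a nonzero vector orthogonal to the first [m - 1]
    eigenvectors, and the Rayleigh quotient of such a vector is at least the [m]-th eigenvalue. *)
Lemma eig_le_max_rayleigh (R : realType) n m (A : 'M[R]_n)
    (W : 'M[R]_(m, n)) c :
  A^T = A -> (0 < m)%N -> row_free W ->
  (forall u, qform A (u *m W) <= c * sqnorm (u *m W)) -> eig A m <= c.
Proof.
case: m W => // m W symA _ freeW ub.
have [P [PPt szA AE]] := spectral_theorem symA.
have lt_mn : (m < n)%N by rewrite -(eqP freeW) rank_leq_col.
(* From here on the test space has dimension [m.+1]. [B] holds the coordinates of its basis along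
   the first [m] eigenvectors; with one row more than columns, it has a nontrivial left kernel. *)
pose B := colsub (widen_ord (ltnW lt_mn)) (W *m P^T).
have [u uB u_neq0] : exists2 u : 'rV_m.+1, u *m B = 0 & u != 0.
  have : kermx B != 0.
    by rewrite kermx_eq0 /row_free neq_ltn ltnS rank_leq_col.
  by case/rowV0Pn => u /sub_kermxP uB u_neq0; exists u.
pose v := u *m W *m P^T.
have v0 (i : 'I_n) : (i < m)%N -> v 0 i = 0.
  move=> im; have /rowP/(_ (Ordinal im)) := uB.
  rewrite mulmx_colsub mulmxA [LHS]mxE [RHS]mxE => <-.
  by congr (fun_of_matrix v _ _); apply: val_inj.
have uWE : u *m W = v *m P by rewrite /v -mulmxA (mulmx1C PPt) mulmx1.
have uW_neq0 : u *m W != 0 by rewrite mulmx_free_eq0.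
have := ub u; rewrite uWE (qform_diag _ AE) -mulmxA PPt mulmx1.
rewrite sqnorm_orthogonal //.
have v_gt0 : 0 < sqnorm v by rewrite -(sqnorm_orthogonal v PPt) -uWE sqnorm_gt0.
move=> le_v; rewrite -(ler_pM2r v_gt0); apply: le_trans le_v.
rewrite sqnormE mulr_sumr; apply: ler_sum => i _; rewrite [(\row_j _) 0 i]mxE.
have [im|mi] := ltnP i m; first by rewrite v0 // expr0n /= !mulr0.
by rewrite ler_wpM2r ?sqr_ge0 // nth_spectrum_le // szA mi ltn_ord.
Qed.

(** The rows of [pid_mx k *m P] are the first [k] eigenvectors, and on their span only eigenvalues
    up to the [k]-th enter the quadratic form. *)
Lemma exists_test_space (R : realType) n k (A : 'M[R]_n) :
  A^T = A -> (0 < k <= n)%N ->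
  exists2 W : 'M[R]_(k, n), row_free W
    & forall u, qform A (u *m W) <= eig A k * sqnorm (u *m W).
Proof.
move=> symA /andP[k_gt0 le_kn]; have [P [PPt szA AE]] := spectral_theorem symA.
have P_unit : P \in unitmx by case/mulmx1_unit: PPt.
have pidfree : row_free (pid_mx k : 'M[R]_(k, n)).
  by rewrite /row_free rank_pid_mx.
exists (pid_mx k *m P) => [|u].
  by rewrite /row_free mxrankMfree // ?row_free_unit.
rewrite mulmxA (qform_diag _ AE) -mulmxA PPt mulmx1 sqnorm_orthogonal //.
rewrite sqnormE mulr_sumr; apply: ler_sum => i _; rewrite [(\row_j _) 0 i]mxE.
have [ik|ki] := ltnP i k; last first.
  rewrite (_ : (u *m _) 0 i = 0) ?expr0n /= ?mulr0 // mxE big1 // => j _.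
  rewrite mxE [_ == _](_ : _ = false) ?mulr0 //; apply/eqP.
  by have := ltn_ord j; lia.
by rewrite ler_wpM2r ?sqr_ge0 // nth_spectrum_le // szA; lia.
Qed.

(** The transplantation argument in matrix form. The lower bound on norms makes [F] injective, so
    the test spaces of [A] and [B] together yield one of dimension [k + l] for [L]; combined with
    the energy bound it controls the Rayleigh quotient there. *)
Lemma eig_le_transplant (R : realType) n p q (L : 'M[R]_n) (A : 'M[R]_p)
    (B : 'M[R]_q) (F : 'M[R]_(p + q, n)) (s : R) k l :
  L^T = L -> A^T = A -> B^T = B -> 0 < s ->
  (forall w, 0 <= qform L w) ->
  (forall a b, s * (sqnorm a + sqnorm b) <= sqnorm (row_mx a b *m F)) ->
  (forall a b, qform L (row_mx a b *m F) <=
     2^-1 * (s * (qform A a + qform B b))) ->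
  (0 < k <= p)%N -> (0 < l <= q)%N ->
  eig L (k + l) <= 2^-1 * Num.max (eig A k) (eig B l).
Proof.
move=> symL symA symB s_gt0 L_ge0 lbF ubF hk hl.
have [WA freeA ubA] := exists_test_space symA hk.
have [WB freeB ubB] := exists_test_space symB hl.
pose W := block_mx WA 0 0 WB *m F; set M := Num.max _ _.
have uWE u : u *m W = row_mx (lsubmx u *m WA) (rsubmx u *m WB) *m F.
  by rewrite mulmxA -{1}[u]hsubmxK mul_row_block !mulmx0 addr0 add0r.
have sq_gt0 u : u != 0 ->
    0 < sqnorm (lsubmx u *m WA) + sqnorm (rsubmx u *m WB).
  move=> u_neq0; rewrite lt0r addr_ge0 ?sqnorm_ge0 // andbT.
  apply: contra u_neq0; rewrite paddr_eq0 ?sqnorm_ge0 // => /andP[].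
  have sq0 m (v : 'rV[R]_m) : (sqnorm v == 0) = (v == 0).
    by have := sqnorm_gt0 v; rewrite lt0r sqnorm_ge0 andbT => /negb_inj.
  rewrite !sq0 => /eqP lu /eqP ru.
  have lu0 : lsubmx u = 0 by apply/eqP; rewrite -(mulmx_free_eq0 _ freeA) lu.
  have ru0 : rsubmx u = 0 by apply/eqP; rewrite -(mulmx_free_eq0 _ freeB) ru.
  by rewrite -(hsubmxK u) lu0 ru0 row_mx0.
have qW u : qform L (u *m W) <=
    2^-1 * M * (s * (sqnorm (lsubmx u *m WA) + sqnorm (rsubmx u *m WB))).
  rewrite uWE; apply: le_trans (ubF _ _) _; rewrite -mulrA.
  rewrite ler_pM2l ?invr_gt0 ?ltr0n // mulrCA ler_pM2l // mulrDr lerD //.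
    by apply: le_trans (ubA _) _; rewrite ler_wpM2r ?sqnorm_ge0 // le_max lexx.
  by apply: le_trans (ubB _) _; rewrite ler_wpM2r ?sqnorm_ge0 // le_max lexx orbT.
have freeW : row_free W.
  apply: inj_row_free => u uW0; apply/eqP/negPn/negP => /sq_gt0 H.
  have := lbF (lsubmx u *m WA) (rsubmx u *m WB).
  have sqnorm0 : sqnorm (0 : 'rV[R]_n) = 0 by rewrite /sqnorm mul0mx mxE.
  by rewrite -uWE uW0 sqnorm0 leNgt mulr_gt0.
have kl_gt0 : (0 < k + l)%N by lia.
(* Multiplying the norm bound [lbF] by [2^-1 * M] requires this factor to be nonnegative. Its sign
   is read off from [qW] at one nonzero vector, because [L] is positive semidefinite. *)
have M_ge0 : 0 <= 2^-1 * M.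
  have u_neq0 : const_mx 1 != 0 :> 'rV[R]_(k + l).
    apply/negP => /eqP/rowP/(_ (Ordinal kl_gt0)); rewrite !mxE => /eqP.
    by rewrite oner_eq0.
  have := le_trans (L_ge0 _) (qW (const_mx 1)).
  by rewrite pmulr_lge0 // mulr_gt0 // sq_gt0.
apply: (eig_le_max_rayleigh symL kl_gt0 freeW) => u.
apply: le_trans (qW u) _; rewrite ler_wpM2l // uWE; exact: lbF.
Qed.

(** * Radial functions and the quadratic form of [Aplus] *)

Lemma Aplus_sym (R : realType) (mu nu : int -> R) T :
  (Aplus mu nu T)^T = Aplus mu nu T.
Proof.
apply/matrixP => i j; rewrite !mxE /Aplus_entry.
have [->//|neq_ij] := eqVneq i j.
have neq : (i%:Z + 1 == j%:Z + 1) = false.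
  by apply/eqP => H; case/eqP: neq_ij; apply: ord_inj; lia.
rewrite neq eq_sym neq distnC [- _ - _]addrC.
by rewrite [mu _ * _]mulrC.
Qed.

(* The value at distance [m] from the separator of the radial test function
   with coordinates [a]; it is constant beyond distance [p]. *)
Definition radial (R : realType) (mu : int -> R) p (a : 'rV[R]_p) (m : nat) :
    R :=
  \sum_(i < p) a 0 i * ((i.+1 == minn m p)%:R / Num.sqrt (mu i.+1%:Z)).

Lemma radial0 (R : realType) (mu : int -> R) p (a : 'rV[R]_p) :
  radial mu a 0 = 0.
Proof. by rewrite /radial min0n big1 // => i _; rewrite mul0r mulr0. Qed.

Lemma radialS (R : realType) (mu : int -> R) p (a : 'rV[R]_p) (i : 'I_p) :
  radial mu a i.+1 = a 0 i / Num.sqrt (mu i.+1%:Z).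
Proof.
rewrite /radial (minn_idPl (ltn_ord i)) (bigD1 i) //= eqxx mul1r.
rewrite big1 ?addr0 // => j neq_ji; rewrite eqSS.
by rewrite [_ == _ :> nat](negPf neq_ji) mul0r mulr0.
Qed.

Lemma radial_ge (R : realType) (mu : int -> R) p (a : 'rV[R]_p) (m : nat) :
  (p <= m)%N -> radial mu a m.+1 = radial mu a m.
Proof. by move=> pm; rewrite /radial !(minn_idPr _) // leqW. Qed.

(** Passes from edges indexed by their lower level to edges indexed by their upper level; the
    hypothesis removes the first term, and the guard keeps the index below [p]. *)
Lemma sum_ord_shift (R : realType) p (h : nat -> R) :
  h 0%N = 0 ->
  \sum_(i < p) h i = \sum_(i < p) (if (i.+1 < p)%N then h i.+1 else 0).
Proof.
move=> h0; case: p => [|p]; first by rewrite !big_ord0.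
rewrite big_ord_recl h0 add0r [RHS]big_ord_recr /= ltnn addr0.
by apply: eq_bigr => i _; rewrite ltnS ltn_ord.
Qed.

(** After the substitution [a_i = f i * sqrt (mu i)], [Aplus] becomes the Laplacian of the path
    [0, ..., p] whose edge from [i] to [i + 1] has weight [nu i + nu (i + 1)], with a Dirichlet
    condition at 0 and a Neumann condition at [p]. *)
Lemma qform_Aplus (R : realType) (mu nu : int -> R) (p : nat) (a : 'rV[R]_p) :
  (forall k : int, 0 < k <= p%:Z -> 0 < mu k) ->
  qform (Aplus mu nu p%:Z) a =
  \sum_(i < p) (nu i%:Z + nu i.+1%:Z)
    * (radial mu a i.+1 - radial mu a i) ^+ 2.
Proof.
move=> mu_gt0; pose c (i : nat) : R := nu i%:Z + nu i.+1%:Z.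
pose f := radial mu a.
have smu (i : 'I_p) : 0 < mu i.+1%:Z by apply: mu_gt0; have := ltn_ord i; lia.
have aE (i : 'I_p) : a 0 i = f i.+1 * Num.sqrt (mu i.+1%:Z).
  by rewrite /f radialS divfK // gt_eqF // sqrtr_gt0.
(* Ordinal [i] is the level [i.+1], whose edges to the levels [i] and [i.+2] have weights [c i] and
   [c i.+1]; at the truncation level the upper edge is absent. *)
have termE (i j : 'I_p) : a 0 i * Aplus mu nu p%:Z i j * a 0 j =
    (if j == i then f i.+1 ^+ 2 * (c i + if (i.+1 < p)%N then c i.+1 else 0) else 0)
    - (if j == i.+1 :> nat then c i.+1 * f i.+1 * f j.+1 else 0)
    - (if i == j.+1 :> nat then c j.+1 * f j.+1 * f i.+1 else 0).
  have sqrt_neq0 (k : 'I_p) : Num.sqrt (mu k.+1%:Z) != 0.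
    by rewrite gt_eqF // sqrtr_gt0.
  have sqrtK (k : 'I_p) : mu k.+1%:Z = Num.sqrt (mu k.+1%:Z) ^+ 2.
    by rewrite sqr_sqrtr // ltW.
  have ZS (k : nat) : k%:Z + 1 = k.+1%:Z by lia.
  have ZSB (k : nat) : k.+1%:Z - 1 = k%:Z by lia.
  rewrite mxE /Aplus_entry !ZS !aE.
  have [->|neq_ji] := eqVneq j i.
    rewrite eqxx; have -> : (nat_of_ord i == i.+1) = false by lia.
    rewrite !subr0 /c.
    have [eq_ip|neq_ip] := eqVneq i.+1%:Z p%:Z.
      have -> : (i.+1 < p)%N = false by lia.
      have pE : p = i.+1 by lia.
      rewrite -eq_ip ZSB [in RHS]addr0 {2}[mu _]sqrtK; field.
      exact: sqrt_neq0.
    have -> : (i.+1 < p)%N by have := ltn_ord i; lia.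
    rewrite ZSB {2}[mu _]sqrtK; field.
    exact: sqrt_neq0.
  have neqn : (j == i :> nat) = false by apply/negbTE.
  have -> : (i.+1%:Z == j.+1%:Z) = false by lia.
  have [ji|ji] := eqVneq (j : nat) i.+1.
    have -> : (`|i.+1%:Z - j.+1%:Z| == 1)%N by lia.
    have -> : (i == j.+1 :> nat) = false by lia.
    rewrite sqrtrM ?ltW // /c sub0r subr0 -ji; field.
    by rewrite sqrt_neq0 ji sqrt_neq0.
  have [ij|ij] := eqVneq (i : nat) j.+1.
    have -> : (`|i.+1%:Z - j.+1%:Z| == 1)%N by lia.
    rewrite sqrtrM ?ltW // /c !sub0r oppr0 add0r -ij; field.
    by apply/andP; split; rewrite ?sqrt_neq0 // ij sqrt_neq0.
  have -> : (`|i.+1%:Z - j.+1%:Z| == 1)%N = false by lia.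
  by rewrite mulr0 mul0r !subr0.
have -> : qform (Aplus mu nu p%:Z) a =
    \sum_(i < p) \sum_(j < p) a 0 i * Aplus mu nu p%:Z i j * a 0 j.
  rewrite exchange_big /qform mxE; apply: eq_bigr => j _.
  by rewrite 2!mxE mulr_suml.
under eq_bigr do under eq_bigr do rewrite termE.
under eq_bigr do rewrite !sumrB.
rewrite !sumrB [X in _ - _ - X]exchange_big /=.
(* The edge between levels 0 and 1 has no off-diagonal entry; it may be included in the sum because
   [f 0 = 0]. *)
have offE : \sum_(i < p) \sum_(j < p)
      (if j == i.+1 :> nat then c i.+1 * f i.+1 * f j.+1 else 0) =
    \sum_(i < p) c i * f i * f i.+1.
  rewrite [RHS](@sum_ord_shift _ p (fun i => c i * f i * f i.+1)); last first.
    by rewrite /f radial0 mulr0 mul0r.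
  apply: eq_bigr => i _; case: ifP => ip.
    rewrite (bigD1 (Ordinal ip)) //= eqxx big1 ?addr0 // => j.
    by rewrite -val_eqE /= => /negPf ->.
  by rewrite big1 // => j _; case: eqP => // jE; have := ltn_ord j; lia.
rewrite offE.
have -> : \sum_(i < p) \sum_(j < p)
    (if j == i then f i.+1 ^+ 2 * (c i + (if (i.+1 < p)%N then c i.+1 else 0)) else 0)
    = \sum_(i < p) c i * f i.+1 ^+ 2 + \sum_(i < p) c i * f i ^+ 2.
  rewrite [X in _ = _ + X](@sum_ord_shift _ p (fun i => c i * f i ^+ 2)); last first.
    by rewrite /f radial0 expr0n mulr0.
  rewrite -big_split; apply: eq_bigr => i _ /=; rewrite -big_mkcond big_pred1_eq.
  by case: ifP => _; ring.
rewrite -big_split -!sumrB; apply: eq_bigr => i _ /=; rewrite -/f /c; ring.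
Qed.

(** * The negative side as a reflection of the positive side *)

Lemma Aminus_entryN (R : realType) (mu nu : int -> R) (T i j : int) :
  Aminus_entry mu nu T i j =
  Aplus_entry (fun k => mu (- k)) (fun k => nu (- k)) (- T) (- i) (- j).
Proof.
rewrite /Aminus_entry /Aplus_entry !eqr_opp !opprK.
have -> : - (- T - 1) = T + 1 by lia.
have -> : - (- i - 1) = i + 1 by lia.
have -> : - (- i + 1) = i - 1 by lia.
have -> : `|(- i + j)%R|%N = `|(i - j)%R|%N by lia.
by rewrite [2 * nu i + _ + _]addrAC.
Qed.

(** [Negz m] is the level [- m.+1]. Ordinals enumerate [{- m.+1, ..., -1}] starting from the
    truncation level, whereas [Aplus] starts next to the separator, so the reflection [k |-> - k]
    reverses their order. *)
Lemma Aminus_rev (R : realType) (mu nu : int -> R) (m : nat) :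
  Aminus mu nu (Negz m) =
  mxsub (@rev_ord m.+1) (@rev_ord m.+1)
    (Aplus (fun k => mu (- k)) (fun k => nu (- k)) m.+1%:Z).
Proof.
apply/matrixP => i j; rewrite !mxE Aminus_entryN.
have levelE (k : 'I_m.+1) : - (Negz m + k%:Z) = (rev_ord k)%:Z + 1.
  by rewrite NegzE /=; have := ltn_ord k; lia.
by congr Aplus_entry; exact: levelE.
Qed.

Definition rev_rv (R : realType) n (b : 'rV[R]_n) : 'rV[R]_n :=
  \row_i b 0 (rev_ord i).

Lemma sqnorm_rev (R : realType) n (b : 'rV[R]_n) :
  sqnorm (rev_rv b) = sqnorm b.
Proof.
rewrite !sqnormE [RHS](reindex_inj rev_ord_inj).
by apply: eq_bigr => i _; rewrite mxE.
Qed.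

Lemma qform_rev (R : realType) n (A : 'M[R]_n) (b : 'rV[R]_n) :
  qform (mxsub (@rev_ord n) (@rev_ord n) A) b = qform A (rev_rv b).
Proof.
rewrite /qform !mxE [LHS](reindex_inj rev_ord_inj).
apply: eq_bigr => i _; rewrite !mxE; congr (_ * _).
rewrite [LHS](reindex_inj rev_ord_inj).
by apply: eq_bigr => j _; rewrite !mxE !rev_ordK.
Qed.

Lemma Aminus_sym (R : realType) (mu nu : int -> R) (m : nat) :
  (Aminus mu nu (Negz m))^T = Aminus mu nu (Negz m).
Proof.
have symP := Aplus_sym (fun k => mu (- k)) (fun k => nu (- k)) m.+1%:Z.
by rewrite Aminus_rev trmx_mxsub; congr (mxsub _ _ _).
Qed.

(** * Graph distance and signed distance along an edge *)

Lemma gdist_edge (V : finType) (e : rel V) x y z :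
  e x y -> (gdist e x z <= (gdist e y z).+1)%N.
Proof.
rewrite /gdist => exy.
set P := fun u n => [exists p : n.-tuple V, path e u p && (last u p == z)].
rewrite -/(P x) -/(P y); set n := find (P y) _.
(* If the search from [y] ends at [#|V| - 1] or later, the bound holds because [gdist] never exceeds
   [#|V|]. Otherwise [y] is prepended to a shortest walk from [y], which gives a walk from [x]. *)
have [le_n|lt_n] := leqP #|V| n.+1.
  by apply: leq_trans (find_size _ _) _; rewrite size_iota.
have hasP : has (P y) (iota 0 #|V|) by rewrite has_find size_iota; lia.
have := nth_find 0%N hasP; rewrite -/n nth_iota ?add0n; last by lia.
case/existsP => p /andP[pathp lastp].
have Px : P x n.+1.
  by apply/existsP; exists [tuple of y :: p]; rewrite /= exy pathp.
rewrite leqNgt; apply/negP => /(before_find 0%N).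
by rewrite nth_iota // add0n Px.
Qed.

Lemma gdistxx (V : finType) (e : rel V) x : gdist e x x = 0%N.
Proof.
rewrite /gdist; have : (0 < #|V|)%N by apply/card_gt0P; exists x.
case: #|V| => //= n _.
rewrite (_ : [exists p, _] = true) //; apply/existsP; exists [tuple].
by rewrite /= eqxx.
Qed.

Lemma gdist_set_edge (V : finType) (e : rel V) (S : {set V}) x y :
  e x y -> (gdist_set e S x <= (gdist_set e S y).+1)%N.
Proof.
move=> exy; apply: (big_ind2 (fun a b => a <= b.+1)%N) => //.
  by move=> a b c d; lia.
by move=> z _; apply: gdist_edge.
Qed.

Lemma gdist_set0 (V : finType) (e : rel V) (S : {set V}) x :
  x \in S -> gdist_set e S x = 0%N.
Proof.
move=> xS; apply/eqP; rewrite -leqn0 -(gdistxx e x) /gdist_set.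
have : x \in index_enum V by rewrite mem_index_enum.
elim: index_enum => // a s IHs; rewrite inE big_cons => /predU1P[<-|/IHs].
  by rewrite xS geq_minl.
by case: ifP => // _ le_x; rewrite (leq_trans (geq_minr _ _)).
Qed.

(** Away from sign changes this is the Lipschitz property of the distance to [S]. An edge leaving
    [Vp] cannot enter [Vm], hence ends in [S], where the distance is 0, so the change of sign causes
    no jump. *)
Lemma signed_dist_edge (V : finType) (e : rel V) (S Vp Vm : {set V}) x y :
  symmetric e -> separates e S Vp Vm -> e x y ->
  (`|signed_dist e S Vp x - signed_dist e S Vp y| <= 1)%N.
Proof.
move=> sym_e [SC _ sep] exy.
have eyx : e y x by rewrite sym_e.
have lexy := gdist_set_edge S exy; have leyx := gdist_set_edge S eyx.
have inS u v : u \in Vp -> v \notin Vp -> e u v -> v \in S.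
  move=> uVp vNVp euv; apply/negPn/negP => vNS.
  have : v \in ~: S by rewrite inE.
  by rewrite SC inE (negPf vNVp) /= => /(sep _ _ uVp); rewrite euv.
rewrite /signed_dist; case: ifPn => xVp; case: ifPn => yVp.
- by lia.
- by move: lexy; rewrite (gdist_set0 e (inS _ _ xVp yVp exy)); lia.
- by move: leyx; rewrite (gdist_set0 e (inS _ _ yVp xVp eyx)); lia.
- by lia.
Qed.

(** * The quadratic form of the Laplacian *)

Lemma sum_enum_rank (R : realType) (V : finType) (F : 'I_#|V| -> R) :
  \sum_i F i = \sum_x F (enum_rank x).
Proof. by rewrite (reindex enum_rank) //; apply/onW_bij/enum_rank_bij. Qed.

Lemma sum_edges_sym (R : realType) (V : finType) (e : rel V) (F : V -> V -> R) :
  symmetric e ->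
  \sum_x \sum_(y | e x y) F x y = \sum_x \sum_(y | e x y) F y x.
Proof.
move=> sym_e; under eq_bigr do rewrite big_mkcond.
rewrite exchange_big; apply: eq_bigr => y _; rewrite [RHS]big_mkcond.
by apply: eq_bigr => x _; rewrite sym_e.
Qed.

Lemma laplacian_mx_sym (R : realType) (V : finType) (e : rel V) d :
  symmetric e -> (laplacian_mx e R d)^T = laplacian_mx e R d.
Proof.
move=> sym_e; apply/matrixP => i j; rewrite !mxE /laplacian; congr (_ * _).
have [->//|neq_ij] := eqVneq i j.
have neq_val : (enum_val i == enum_val j) = false.
  by rewrite (inj_eq enum_val_inj) (negPf neq_ij).
rewrite neq_val eq_sym neq_val !sumrB; congr (_ - _).
  by rewrite !big1.
have edgeE a b : \sum_(y | e a y) (y == b)%:R = (e a b)%:R :> R.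
  case: (boolP (e a b)) => eab.
    by rewrite (bigD1 b) //= eqxx big1 ?addr0 // => y /andP[_ /negPf ->].
  by rewrite big1 // => y eay; case: eqP => // yb; rewrite -yb eay in eab.
by rewrite !edgeE sym_e.
Qed.

(** Summation by parts: the sum of [f x * (f x - f y)] over ordered edges is averaged with its copy
    in which [x] and [y] are exchanged. Every edge is counted in both directions, whence the factor
    [2^-1]. *)
Lemma qform_laplacian (R : realType) (V : finType) (e : rel V) d
    (w : 'rV[R]_#|V|) :
  symmetric e ->
  qform (laplacian_mx e R d) w = 2^-1 * (d%:R^-1 *
    \sum_x \sum_(y | e x y) (w 0 (enum_rank x) - w 0 (enum_rank y)) ^+ 2).
Proof.
move=> sym_e; pose f x := w 0 (enum_rank x).
pose S := \sum_x \sum_(y | e x y) f x * (f x - f y).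
have -> : qform (laplacian_mx e R d) w = d%:R^-1 * S.
  have -> : qform (laplacian_mx e R d) w =
      \sum_i w 0 i * \sum_j laplacian_mx e R d i j * w 0 j.
    rewrite /qform mxE; under eq_bigr do rewrite 2!mxE mulr_suml.
    rewrite exchange_big; apply: eq_bigr => i _; rewrite mulr_sumr.
    by apply: eq_bigr => j _; rewrite mulrA.
  rewrite sum_enum_rank mulr_sumr; apply: eq_bigr => x _.
  rewrite -mulr_sumr mulrCA; congr (_ * _).
  rewrite sum_enum_rank.
  under eq_bigr do rewrite mxE /laplacian !enum_rankK -mulrA mulr_suml.
  rewrite -mulr_sumr; congr (_ * _); rewrite exchange_big.
  apply: eq_bigr => y _.
  under eq_bigr do rewrite mulrBl.
  have dE a : \sum_z (a == z)%:R * w 0 (enum_rank z) = f a.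
    rewrite (bigD1 a) //= eqxx mul1r big1 ?addr0 // => z.
    by rewrite eq_sym => /negPf ->; rewrite mul0r.
  by rewrite sumrB !dE.
rewrite mulrCA; congr (_ * _).
suff : \sum_x \sum_(y | e x y) (f x - f y) ^+ 2 = 2 * S.
  by rewrite /f => ->; rewrite mulKf // pnatr_eq0.
have SE : S = \sum_x \sum_(y | e x y) f y * (f y - f x).
  exact: sum_edges_sym.
rewrite mulr2n mulrDl mul1r {2}SE /S -big_split.
apply: eq_bigr => x _; rewrite -big_split; apply: eq_bigr => y _ /=; ring.
Qed.

Lemma qform_laplacian_ge0 (R : realType) (V : finType) (e : rel V) d
    (w : 'rV[R]_#|V|) :
  symmetric e -> 0 <= qform (laplacian_mx e R d) w.
Proof.
move=> sym_e; rewrite qform_laplacian // !mulr_ge0 ?invr_ge0 ?ler0n //.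
by do 2!apply: sumr_ge0 => ? _; rewrite sqr_ge0.
Qed.

(** * Energy and norm of radial functions, level by level *)

(** The squared increment [g j] belongs to the edges joining levels [j] and [j + 1] and is a summand
    of [G] at both ends of such an edge, so the mean of [G] over the two ends dominates the energy
    of the edge. By regularity each vertex collects its share [d] times. *)
Lemma edge_energy_le (R : realType) (V : finType) (e : rel V) d
    (sigma : V -> int) (phi g : int -> R) :
  symmetric e -> regular_graph e d ->
  (forall x y, e x y -> (`|sigma x - sigma y| <= 1)%N) ->
  (forall j, g j = (phi (j + 1) - phi j) ^+ 2) ->
  \sum_x \sum_(y | e x y) (phi (sigma x) - phi (sigma y)) ^+ 2 <=
  d%:R * \sum_x (g (sigma x) + g (sigma x - 1)).
Proof.
move=> sym_e reg_e lip gE; pose G j := g j + g (j - 1).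
have g_ge0 j : 0 <= g j by rewrite gE sqr_ge0.
have -> : d%:R * \sum_x G (sigma x) =
    \sum_x \sum_(y | e x y) (2^-1 * G (sigma x) + 2^-1 * G (sigma y)).
  have halfE : \sum_x \sum_(y | e x y) 2^-1 * G (sigma x) =
      2^-1 * (d%:R * \sum_x G (sigma x)).
    rewrite !mulr_sumr; apply: eq_bigr => x _.
    by rewrite sumr_const -(reg_e x) cardsE -[LHS]mulr_natl mulrCA.
  under [RHS]eq_bigr do rewrite big_split /=.
  rewrite [RHS]big_split /= halfE.
  rewrite (_ : \sum_x \sum_(y | e x y) 2^-1 * G (sigma y) =
      2^-1 * (d%:R * \sum_x G (sigma x))).
    by field.
  by rewrite sum_edges_sym.
rewrite ler_sum // => x _; rewrite ler_sum // => y exy.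
have : [\/ sigma x = sigma y, sigma x = sigma y + 1 | sigma y = sigma x + 1].
  have := lip _ _ exy.
  by case: (ltgtP (sigma x) (sigma y)) => ? ?;
    [apply: Or33|apply: Or32|apply: Or31]; lia.
case=> ->.
- by rewrite subrr expr0n addr_ge0 // mulr_ge0 ?invr_ge0 ?ler0n ?addr_ge0.
- have := g_ge0 (sigma y + 1); have := g_ge0 (sigma y - 1).
  by rewrite /G addrK -gE; lra.
- have := g_ge0 (sigma x + 1); have := g_ge0 (sigma x - 1).
  rewrite /G addrK -[(phi _ - _) ^+ 2]sqrrN opprB -gE; lra.
Qed.

(** As [g] is supported on [{-q, ..., p - 1}], it is a finite combination of indicators of integers,
    and exchanging the sums counts the vertices of each level. The shift [c] covers both
    [g (sigma x)] and [g (sigma x - 1)]. *)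
Lemma sum_by_level (R : realType) (V : finType) (sigma : V -> int)
    (g : int -> R) (p q : nat) (c : int) :
  (forall m : nat, (p <= m)%N -> g m%:Z = 0) ->
  (forall m : nat, (q <= m)%N -> g (Negz m) = 0) ->
  \sum_x g (sigma x - c) =
  \sum_(i < p) g i%:Z * #|[set x | sigma x == i%:Z + c]|%:R +
  \sum_(i < q) g (Negz i) * #|[set x | sigma x == Negz i + c]|%:R.
Proof.
move=> gp gq.
have gE j : g j = \sum_(i < p) g i%:Z * (j == i%:Z)%:R
                + \sum_(i < q) g (Negz i) * (j == Negz i)%:R.
  case: j => m.
    rewrite [X in _ + X]big1 ?addr0 => [|i _]; last by rewrite mulr0.
    have [mp|/gp g0] := ltnP m p.
      rewrite (bigD1 (Ordinal mp)) //= eqxx mulr1 big1 ?addr0 // => i.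
      by rewrite -val_eqE eq_sym /= eqz_nat => /negPf ->; rewrite mulr0.
    rewrite g0 big1 // => i _; rewrite eqz_nat.
    by case: eqP => [<-|]; rewrite ?g0 ?mul0r ?mulr0.
  rewrite [X in X + _]big1 ?add0r => [|i _]; last by rewrite mulr0.
  have NegzI i : (Negz m == Negz i) = (m == i) by [].
  have [mq|/gq g0] := ltnP m q.
    rewrite (bigD1 (Ordinal mq)) //= eqxx mulr1 big1 ?addr0 // => i.
    by rewrite -val_eqE eq_sym /= NegzI => /negPf ->; rewrite mulr0.
  rewrite g0 big1 // => i _; rewrite NegzI.
  by case: eqP => [<-|]; rewrite ?g0 ?mul0r ?mulr0.
have cardE k : #|[set x | sigma x == k + c]|%:R = \sum_x (sigma x - c == k)%:R :> R.
  rewrite -sum1_card natr_sum big_mkcond; apply: eq_bigr => x _.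
  by rewrite inE subr_eq; case: eqP.
under eq_bigr do rewrite gE.
rewrite big_split; congr (_ + _); rewrite exchange_big; apply: eq_bigr => i _;
  by rewrite cardE mulr_sumr.
Qed.

(** At level [i] the squared value is [a_i ^ 2 / mu i] and at least [s * mu i] vertices share it, so
    the weights cancel; the remaining levels contribute squares and are dropped. *)
Lemma sqnorm_le_levels (R : realType) (V : finType) (sigma : V -> int)
    (mu mu' : int -> R) (s : R) p q (a : 'rV[R]_p) (b : 'rV[R]_q)
    (phi : int -> R) :
  (forall k, mu' k = mu (- k)) ->
  (forall i : 'I_p, 0 < mu i.+1%:Z) -> (forall i : 'I_q, 0 < mu' i.+1%:Z) ->
  (forall k, s * mu k <= #|[set x | sigma x == k]|%:R) ->
  (forall n : nat, phi n%:Z = radial mu a n) ->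
  (forall n : nat, phi (Negz n) = radial mu' b n.+1) ->
  s * (sqnorm a + sqnorm b) <= \sum_x phi (sigma x) ^+ 2.
Proof.
move=> mu'E mu_gt0 mu'_gt0 level phiP phiN.
have radial_sqr (w : int -> R) n (c : 'rV[R]_n) (i : 'I_n) : 0 < w i.+1%:Z ->
    radial w c i.+1 ^+ 2 * w i.+1%:Z = c 0 i ^+ 2.
  move=> w_gt0; rewrite radialS expr_div_n sqr_sqrtr ?ltW // divfK //.
  by rewrite gt_eqF.
(* [h1] at [n] records level [n + 1], hence its argument [sigma x - 1] below; [h2] at [Negz n]
   records level [- n.+1] without a shift. *)
pose h1 j := if j is Posz n then
  (if (n < p)%N then radial mu a n.+1 ^+ 2 else 0) else 0.
pose h2 j := if j is Negz n then
  (if (n < q)%N then radial mu' b n.+1 ^+ 2 else 0) else 0.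
have le_h j : h1 (j - 1) + h2 (j - 0) <= phi j ^+ 2.
  rewrite subr0; case: j => [[|n]|n].
  - by rewrite /= addr0 sqr_ge0.
  - rewrite (_ : n.+1%:Z - 1 = n%:Z) /= ?addr0 ?phiP; last by lia.
    by case: ifP => _; rewrite ?sqr_ge0.
  - rewrite (_ : Negz n - 1 = Negz n.+1) /= ?add0r ?phiN; last by lia.
    by case: ifP => _; rewrite ?sqr_ge0.
apply: (@le_trans _ _ (\sum_x (h1 (sigma x - 1) + h2 (sigma x - 0)))); last first.
  by apply: ler_sum => x _; apply: le_h.
rewrite big_split /= (@sum_by_level _ _ _ h1 p 0); first last.
- by [].
- by move=> n; rewrite /h1 ltnNge => ->.
rewrite (@sum_by_level _ _ _ h2 0 q); first last.
- by move=> n; rewrite /h2 ltnNge => ->.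
- by [].
rewrite !big_ord0 addr0 add0r mulrDr lerD // sqnormE mulr_sumr; apply: ler_sum => i _.
  rewrite /h1 ltn_ord -(radial_sqr mu) // mulrCA ler_wpM2l ?sqr_ge0 //.
  by rewrite (_ : i%:Z + 1 = i.+1%:Z) //; lia.
rewrite /h2 ltn_ord -(radial_sqr mu') // mulrCA ler_wpM2l ?sqr_ge0 //.
by rewrite addr0 NegzE mu'E; apply: level.
Qed.

(** The increment between two consecutive levels is weighted by the sum of their sizes, which is at
    most [s] times the edge weight in [qform_Aplus]. Beyond the truncation levels [phi] is constant
    and the increments vanish. *)
Lemma energy_le_levels (R : realType) (V : finType) (sigma : V -> int)
    (mu mu' nu nu' : int -> R) (s : R) p q (a : 'rV[R]_p) (b : 'rV[R]_q)
    (phi g : int -> R) :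
  (forall k, nu' k = nu (- k)) ->
  (forall k : int, 0 < k <= p%:Z -> 0 < mu k) ->
  (forall k : int, 0 < k <= q%:Z -> 0 < mu' k) ->
  (forall k, #|[set x | sigma x == k]|%:R <= s * nu k) ->
  (forall n : nat, phi n%:Z = radial mu a n) ->
  (forall n : nat, phi (Negz n) = radial mu' b n.+1) ->
  (forall j, g j = (phi (j + 1) - phi j) ^+ 2) ->
  \sum_x (g (sigma x) + g (sigma x - 1)) <=
    s * (qform (Aplus mu nu p%:Z) a + qform (Aplus mu' nu' q%:Z) b).
Proof.
move=> nu'E mu_gt0 mu'_gt0 level phiP phiN gE.
have gP (n : nat) : g n%:Z = (radial mu a n.+1 - radial mu a n) ^+ 2.
  by rewrite gE (_ : n%:Z + 1 = n.+1%:Z) ?phiP //; lia.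
have gN (n : nat) : g (Negz n) = (radial mu' b n.+1 - radial mu' b n) ^+ 2.
  rewrite gE -sqrrN opprB phiN; congr ((_ - _) ^+ 2); case: n => [|n].
    by rewrite (_ : Negz 0 + 1 = 0%:Z) // phiP !radial0.
  by rewrite (_ : Negz n.+1 + 1 = Negz n) ?phiN //; lia.
have g_ge0 j : 0 <= g j by rewrite gE sqr_ge0.
have gP0 (n : nat) : (p <= n)%N -> g n%:Z = 0.
  by move=> pn; rewrite gP radial_ge // subrr expr0n.
have gN0 (n : nat) : (q <= n)%N -> g (Negz n) = 0.
  by move=> qn; rewrite gN radial_ge // subrr expr0n.
under eq_bigr do rewrite -[X in g X + _]subr0.
rewrite big_split /= !(sum_by_level _ _ gP0 gN0) addrACA -!big_split /=.
rewrite !qform_Aplus // mulrDr; apply: lerD; rewrite mulr_sumr; apply: ler_sum => i _.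
  rewrite -mulrDr gP mulrC mulrA ler_wpM2r ?sqr_ge0 // mulrDr addr0.
  by rewrite (_ : i%:Z + 1 = i.+1%:Z) ?lerD //; lia.
rewrite -mulrDr gN mulrC mulrA ler_wpM2r ?sqr_ge0 // mulrDr addr0.
rewrite (_ : Negz i + 1 = - i%:Z); last by lia.
by rewrite addrC !nu'E -NegzE lerD.
Qed.

(** * The eigenvalue bound for given truncation levels *)

(** The truncation levels are arbitrary and independent of each other, so that both estimates of the
    theorem are instances. *)
Lemma lambda_le_max_rho (R : realType) (V : finType) (e : rel V) (d : nat)
    (Sigma Vp Vm : {set V}) (nu mu : int -> R) (tp tm : int) (k l : nat) :
  simple_graph e -> regular_graph e d -> Sigma != set0 ->
  separates e Sigma Vp Vm ->
  (forall k : int,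
     #|Sigma|%:R * mu k <= #|[set x | signed_dist e Sigma Vp x == k]|%:R
       <= #|Sigma|%:R * nu k) ->
  admissible_plus mu tp -> admissible_minus mu tm ->
  (1 <= k <= `|tp|)%N -> (1 <= l <= `|tm|)%N ->
  lambda R e d (k + l) <=
    2^-1 * Num.max (rho_plus mu nu tp k) (rho_minus mu nu tm l).
Proof.
move=> [sym_e _] reg_e Sigma_neq0 sep level [].
case: tp => // p _ mu_p []; case: tm => // m _ mu_m /= kp lq.
pose q := m.+1; pose s : R := #|Sigma|%:R; pose sigma := signed_dist e Sigma Vp.
pose mu' j := mu (- j); pose nu' j := nu (- j).
have s_gt0 : 0 < s by rewrite ltr0n card_gt0.
have mu_gt0 (j : int) : 0 < j <= p%:Z -> 0 < mu j.
  by move=> /andP[j_gt0 jp]; apply: mu_p; rewrite ltW.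
have mu'_gt0 (j : int) : 0 < j <= q%:Z -> 0 < mu' j.
  by move=> /andP[j_gt0 jq]; apply: mu_m; rewrite NegzE; lia.
pose posp j := if j is Posz n then n else 0%N.
pose negp j := if j is Negz n then n.+1 else 0%N.
pose phi (a : 'rV[R]_p) (b : 'rV[R]_q) j :=
  radial mu a (posp j) + radial mu' (rev_rv b) (negp j).
have phiP a b (n : nat) : phi a b n%:Z = radial mu a n.
  by rewrite /phi radial0 addr0.
have phiN a b (n : nat) : phi a b (Negz n) = radial mu' (rev_rv b) n.+1.
  by rewrite /phi radial0 add0r.
(* [F] is the matrix of the linear map from pairs of coordinate vectors to test functions; [rev_ord]
   in the lower block follows the ordering of the levels in [Aminus]. *)
pose F : 'M[R]_(p + q, #|V|) := col_mx
  (\matrix_(i, x) ((i.+1 == minn (posp (sigma (enum_val x))) p)%:R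
                   / Num.sqrt (mu i.+1%:Z)))
  (\matrix_(i, x) (((rev_ord i).+1 == minn (negp (sigma (enum_val x))) q)%:R
                   / Num.sqrt (mu' (rev_ord i).+1%:Z))).
have FE a b x : (row_mx a b *m F) 0 (enum_rank x) = phi a b (sigma x).
  rewrite mul_row_col mxE; congr (_ + _); rewrite mxE.
    by apply: eq_bigr => i _; rewrite mxE enum_rankK.
  rewrite (reindex_inj rev_ord_inj); apply: eq_bigr => i _.
  by rewrite !mxE enum_rankK !rev_ordK.
apply: (@eig_le_transplant _ _ p q (laplacian_mx e R d) (Aplus mu nu p%:Z)
  (Aminus mu nu (Negz m)) F s) => //.
- exact: laplacian_mx_sym.
- by have := Aplus_sym mu nu p%:Z.
- by have := Aminus_sym mu nu m.
- by move=> w; apply: qform_laplacian_ge0.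
- move=> a b; rewrite -(sqnorm_rev b) [leRHS]sqnormE sum_enum_rank.
  under eq_bigr do rewrite FE.
  apply: (@sqnorm_le_levels _ _ _ mu mu') => [//|i|i|j|//|//].
  + by apply: mu_gt0; have := ltn_ord i; lia.
  + by apply: mu'_gt0; have := ltn_ord i; lia.
  + by case/andP: (level j).
- move=> a b; rewrite qform_laplacian // ler_pM2l ?invr_gt0 ?ltr0n //.
  under eq_bigr do under eq_bigr do rewrite !FE.
  pose g j := (phi a b (j + 1) - phi a b j) ^+ 2.
  have energy := @edge_energy_le _ _ _ _ sigma (phi a b) g sym_e reg_e
    (fun x y => signed_dist_edge sym_e sep) (fun=> erefl).
  (* This settles the degenerate case [d = 0], where [d%:R^-1] is 0 by convention and cannot cancel
     the factor [d%:R]. *)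
  have g_ge0 : 0 <= \sum_x (g (sigma x) + g (sigma x - 1)).
    by apply: sumr_ge0 => x _; rewrite addr_ge0 ?sqr_ge0.
  rewrite Aminus_rev qform_rev.
  have level_nu j : #|[set x | sigma x == j]|%:R <= s * nu j.
    by case/andP: (level j).
  have nu'E j : nu' j = nu (- j) by [].
  apply: le_trans (energy_le_levels nu'E mu_gt0 mu'_gt0 level_nu
    (phiP a b) (phiN a b) (fun=> erefl)).
  apply: le_trans (ler_wpM2l _ energy) _; first by rewrite invr_ge0 ler0n.
  by have [->|d_neq0] := eqVneq d 0%N; rewrite ?invr0 ?mul0r // mulKf // pnatr_eq0.
Qed.

(** * Existence of the minimum over truncation levels and indices *)

Lemma exists_is_minimum (R : realType) (P : R -> Prop) (s : seq R) :
  (exists r, P r) -> (forall r, P r -> r \in s) -> exists m, is_minimum P m.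
Proof.
move=> [r0 Pr0] Ps.
have seq_min (t : seq R) : t != [::] ->
    exists2 m, m \in t & {in t, forall r, m <= r}.
  elim: t => // a [_ _|b t /(_ isT)[m mt mP] _].
    by exists a; rewrite ?mem_head // => r; rewrite inE => /eqP ->.
  have [am|ma] := leP a m.
    exists a; rewrite ?mem_head // => r; rewrite inE => /predU1P[->//|/mP].
    exact: le_trans.
  exists m; first by rewrite inE mt orbT.
  by move=> r; rewrite inE => /predU1P[->|/mP //]; apply: ltW.
have /seq_min[m] : [seq r <- s | `[< P r >]] != [::].
  apply/eqP => H; have : r0 \in [seq r <- s | `[< P r >]].
    by rewrite mem_filter Ps // andbT; apply/asboolP.
  by rewrite H.
rewrite mem_filter => /andP[/asboolP Pm _] mP; exists m; split=> // r Pr.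
by apply: mP; rewrite mem_filter Ps // andbT; apply/asboolP.
Qed.

Lemma max_rho_values_minimum (R : realType) (mu nu : int -> R) (Tp Tm : int)
    (j : nat) :
  admissible_plus mu Tp -> admissible_minus mu Tm ->
  (2 <= j <= 2 * minn `|Tm| `|Tp|)%N ->
  exists m, is_minimum (max_rho_values mu nu (minn `|Tm| `|Tp|) j) m.
Proof.
move=> [Tp_gt0 mu_p] [Tm_lt0 mu_m]; set T := minn _ _ => hj.
have T_gt0 : (0 < T)%N by lia.
(* The constraints bound [tp], [tm], [k] and [l] by [2 * T] in absolute value, so all candidate
   values lie in the finite image of [val]. *)
pose N := (2 * T).+1.
pose val (c : 'I_N * 'I_N * ('I_N * 'I_N)) : R :=
  Num.max (rho_plus mu nu (c.1.1 : nat)%:Z c.2.1)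
          (rho_minus mu nu (- (c.1.2 : nat)%:Z) c.2.2).
apply: (@exists_is_minimum _ _ (codom val)).
  (* The candidate set is nonempty: with truncation levels [T] and [- T], this choice puts both [k]
     and [j - k] between 1 and [T]. *)
  pose k := maxn 1 (j - T).
  exists (Num.max (rho_plus mu nu T%:Z k) (rho_minus mu nu (- T%:Z) (j - k))).
  exists k, (j - k)%N, T%:Z, (- T%:Z); split=> //; rewrite ?abszN /=; try lia.
  split; last by lia.
  - by split=> [|i hi]; [lia|apply: mu_p; lia].
  - by split=> [|i hi]; [lia|apply: mu_m; lia].
move=> r [k [l [tp [tm [jE [[tp_gt0 _] [tm_lt0 _] hT] hk hl ->]]]]].
have tpN : (`|tp| < N)%N by lia.
have tmN : (`|tm| < N)%N by lia.
have kN : (k < N)%N by lia.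
have lN : (l < N)%N by lia.
apply/codomP; exists ((Ordinal tpN, Ordinal tmN), (Ordinal kN, Ordinal lN)).
by rewrite /val /= gtz0_abs // ltz0_abs // opprK.
Qed.

Theorem theorem5p4 (R : realType) (V : finType) (e : rel V) (d : nat)
  (Sigma Vp Vm : {set V}) (nu mu : int -> R) (Tp Tm : int)
  (G_simple : simple_graph e)
  (G_connected : connected_graph e)
  (G_regular : regular_graph e d)
  (Sigma_neq0 : Sigma != set0)
  (Sigma_sep : separates e Sigma Vp Vm)
  (level_bounds : forall k : int,
     #|Sigma|%:R * mu k <= #|[set x | signed_dist e Sigma Vp x == k]|%:R
       <= #|Sigma|%:R * nu k)
  (Tp_gt0 : 0 < Tp) (mu_Tp : forall k : int, 0 <= k <= Tp -> 0 < mu k)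
  (Tm_lt0 : Tm < 0) (mu_Tm : forall k : int, Tm <= k <= 0 -> 0 < mu k) :
  let T := minn `|Tm|%N `|Tp|%N in
  (forall k l : nat, (1 <= k <= T)%N -> (1 <= l <= T)%N ->
     lambda R e d (k + l) <=
       2^-1 * Num.max (rho_plus mu nu Tp k) (rho_minus mu nu Tm l))
  /\
  (forall j : nat, (2 <= j <= 2 * T)%N ->
     exists m : R, is_minimum (max_rho_values mu nu T j) m /\
       lambda R e d j <= 2^-1 * m).
Proof.
move=> T; have adm_p : admissible_plus mu Tp by [].
have adm_m : admissible_minus mu Tm by [].
split=> [k l hk hl|j hj].
  by apply: (lambda_le_max_rho G_simple G_regular Sigma_neq0 Sigma_sep) => //; lia.
have [m min_m] := max_rho_values_minimum nu adm_p adm_m hj.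
(* The minimum is attained at an admissible choice of parameters, to which the bound applies
   directly. *)
exists m; split=> //; case: min_m => -[k [l [tp [tm [-> [atp atm _] hk hl ->]]]]] _.
exact: (lambda_le_max_rho G_simple G_regular Sigma_neq0 Sigma_sep).
Qed.
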